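(* Let $(E,d)$ be a complete geodesic space with convex metric and let $A\in P_{cl}(E)$ and $B\in P_{b,cl,cv}(E)$ be such that $\lambda_{AB}>0$. Suppose $\epsilon>0$. Then there exists $a\in A$ such that (i) $\mathrm{dist}(a,B)<\lambda_{AB}+\epsilon$, (ii) $\overline{\mathrm{co}}\left(B\cup\{a\}\right)\cap A=\{a\}$, and (iii) $x_n\to a$ for every sequence $(x_n)_{n\in\mathbb{N}}$ in $\overline{\mathrm{co}}\left(B\cup\{a\}\right)$ with $\mathrm{dist}(x_n,A)\to 0$.
   Context: Let $(E,d)$ be a metric space. A geodesic path from $x$ to $y$ is a map $c:[0,l]\to E$ with $c(0)=x$, $c(l)=y$ and $d(c(t),c(t'))=|t-t'|$ for all $t,t'\in[0,l]$; its image is a geodesic segment joining $x$ and $y$. $E$ is a geodesic space if every two points are joined by a geodesic path. A subset is convex if every geodesic segment joining two of its points is contained in it. The metric of a geodesic space is convex if for any geodesic paths $c_1:[0,l_1]\to E$, $c_2:[0,l_2]\to E$ with $c_1(0)=c_2(0)$ one has $d(c_1(tl_1),c_2(tl_2))\le t\,d(c_1(l_1),c_2(l_2))$ for all $t\in[0,1]$. For $X\subseteq E$, $G_1(X)$ is the union of all geodesic segments with endpoints in $X$, $G_n(X)=G_1(G_{n-1}(X))$ for $n\ge 2$, the convex hull is $\mathrm{co}(X)=\bigcup_{n\in\mathbb{N}}G_n(X)$, and $\overline{\mathrm{co}}(X)$ is the closure of $\mathrm{co}(X)$. $P_{cl}(E)$ is the family of nonempty closed subsets of $E$; $P_{b,cl,cv}(E)$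 is the family of nonempty, bounded, closed, convex subsets of $E$. $\mathrm{dist}(z,X)=\inf_{x\in X}d(z,x)$ and $\lambda_{AB}=\inf\{d(a,b):a\in A,b\in B\}$. *)

(* Defs.v *)
From HB Require Import structures.
From mathcomp Require Import all_boot all_order all_algebra.
From mathcomp Require Import all_classical all_reals all_analysis.

Set Implicit Arguments.
Unset Strict Implicit.
Unset Printing Implicit Defensive.

Import Order.TTheory GRing.Theory Num.Theory.
Import numFieldNormedType.Exports.

Local Open Scope classical_set_scope.
Local Open Scope ring_scope.

(* [Complete] asks for a base point; in the theorem the space is nonempty
   anyway, since it has a nonempty subset. *)
#[short(type="completeMetricType")]
HB.structure Definition CompleteMetric (R : realType) :=
  {E of Complete E & Metric R E}.

Section GeodesicSpaces.
Context {R : realType} {E : metricType R}.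
Implicit Types (x y z : E) (X Y : set E).

(* A path [0, l] -> E is the restriction to [0, l] of a total function. *)
Definition geodesic_path (c : R -> E) (l : R) (x y : E) : Prop :=
  [/\ 0 <= l, c 0 = x, c l = y &
      forall t t', t \in `[0, l] -> t' \in `[0, l] ->
        mdist (c t) (c t') = `|t - t'|].

Definition geodesic_segment (S : set E) (x y : E) : Prop :=
  exists (c : R -> E) (l : R), geodesic_path c l x y /\ S = c @` `[0, l].

Definition geodesically_convex X : Prop :=
  forall x y (S : set E), X x -> X y -> geodesic_segment S x y -> S `<=` X.

Definition geodesic_hull1 X : set E :=
  [set z | exists x y (S : set E),
    [/\ X x, X y, geodesic_segment S x y & S z]].

Definition geodesic_hulln (n : nat) X : set E := iter n geodesic_hull1 X.

Definition convex_hull X : set E :=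
  \bigcup_(n in [set n | (1 <= n)%N]) geodesic_hulln n X.

Definition closed_convex_hull X : set E := closure (convex_hull X).

Definition metric_bounded X : Prop :=
  exists M : R, forall x y, X x -> X y -> mdist x y <= M.

(* The infima below are taken in [R]; as [inf set0 = 0], they have their usual
   meaning only for nonempty [X] and [Y]. *)
Definition dist_to_set z X : R := inf [set mdist z x | x in X].

Definition dist_sets X Y : R :=
  inf [set r | exists x y, [/\ X x, Y y & r = mdist x y]].

End GeodesicSpaces.

Definition geodesic_space {R : realType} (E : metricType R) : Prop :=
  forall x y : E, exists (c : R -> E) (l : R), geodesic_path c l x y.

Definition convex_metric {R : realType} (E : metricType R) : Prop :=
  forall (c1 c2 : R -> E) (l1 l2 : R) (x y1 y2 : E),
    geodesic_path c1 l1 x y1 -> geodesic_path c2 l2 x y2 ->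
    forall t : R, t \in `[0, 1] ->
      mdist (c1 (t * l1)) (c2 (t * l2)) <= t * mdist (c1 l1) (c2 l2).

(* Main.v *)
Require Import Defs.
From HB Require Import structures.
From mathcomp Require Import all_boot all_order all_algebra.
From mathcomp Require Import all_classical all_reals all_analysis.
From mathcomp Require Import ring lra.

Set Implicit Arguments.
Unset Strict Implicit.
Unset Printing Implicit Defensive.

Import Order.TTheory GRing.Theory Num.Theory.
Import numFieldNormedType.Exports.

Local Open Scope classical_set_scope.
Local Open Scope ring_scope.

(** Let [f = dist (., B)] and [C = diam B / lambda + 1], so that
    [d (b, a) <= C * f a] for all [a] in [A] and [b] in [B].  In a geodesic space
    with convex metric [x |-> C * f x + d (x, a)] is convex and Lipschitz, and it
    is at most [C * f a] on [B] and at [a], hence on the whole drop: the drop lies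
    in the petal [{x | C * f x + d (x, a) <= C * f a}].  Ekeland's variational
    principle on [A] for [(C + 1) * f] gives an [a] with
    [(C + 1) * f a < (C + 1) * f y + d (a, y)] for the other points [y] of [A], so
    the petal meets [A] only at [a]; the gap between [C] and [C + 1] absorbs the
    errors made by points that are only close to [A]. *)

(** * Ekeland's variational principle on a closed set *)

Section Ekeland.
Context {R : realType} {E : completeMetricType R}.
Variables (A : set E) (phi : E -> R) (m : R).
Hypotheses (A_closed : closed A)
  (phi_lsc : forall K, closed [set x | phi x <= K])
  (phi_ge : forall x, A x -> m <= phi x).

(** Ekeland's order: a move to [y] must lower [phi] by at least the distance travelled. *)
Let below (x y : E) := A y /\ phi y + mdist x y <= phi x.

Let below_refl x : A x -> below x x.
Proof. by move=> Ax; split; rewrite // mdistxx addr0. Qed.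

Let below_trans x y z : below x y -> below y z -> below x z.
Proof.
move=> [_ xy] [Az yz]; split=> //.
have := metric_triangle x y z; lra.
Qed.

(** The premise [A x] stands under the quantifier so that choosing [y] gives a total function of
    [x]. *)
Let near_minimal (n : nat) (x : E) : exists y, A x ->
  below x y /\ forall z, below x z -> phi y <= phi z + n.+1%:R^-1.
Proof.
have [Ax|nAx] := pselect (A x); last by exists x.
pose V := phi @` below x.
have V_inf : has_inf V.
  split; first by exists (phi x), x => //; exact: below_refl.
  by exists m => _ [y [Ay _] <-]; exact: phi_ge.
have n_gt0 : 0 < n.+1%:R^-1 :> R by rewrite invr_gt0 ltr0n.
have [_ [y xy <-] y_lt] := inf_adherent n_gt0 V_inf.
exists y => _; split=> // z xz.
rewrite (le_trans (ltW y_lt))// lerD2r.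
by apply: ge_inf; [exact: V_inf.2 | exists z].
Qed.

(** Iterating near-minimal choices yields a descending sequence. It is Cauchy because the decrease
    of [phi] bounds the distances, and its limit lies below all its terms. *)
Lemma ekeland_variational_principle x0 : A x0 ->
  exists a, [/\ A a, phi a + mdist x0 a <= phi x0 &
    forall y, A y -> phi y + mdist a y <= phi a -> y = a].
Proof.
move=> Ax0.
pose next n x := sval (cid (near_minimal n x)).
have nextP n x : A x -> below x (next n x) /\
    forall z, below x z -> phi (next n x) <= phi z + n.+1%:R^-1.
  exact: (svalP (cid (near_minimal n x))).
pose fix s n := if n is k.+1 then next k (s k) else x0.
have As n : A (s n) by elim: n => //= n IH; have [[]] := nextP n _ IH.
have s_below n k : (n <= k)%N -> below (s n) (s k).
  move=> /subnKC <-; elim: (k - n)%N => [|i IH].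
    by rewrite addn0; exact: below_refl.
  have [step _] := nextP (n + i)%N _ (As (n + i)%N).
  by rewrite addnS; exact: below_trans IH step.
have s_cauchy : cauchy (s @ \oo).
  apply: (@cauchy_exP R) => e e_gt0.
  pose V := range (phi \o s).
  have V_inf : has_inf V.
    split; first by exists (phi (s 0%N)), 0%N.
    by exists m => _ [n _ <-]; exact/phi_ge.
  (* Once [phi (s n)] is within [e] of the infimum, every later term is within [e] of [s n]. *)
  have [_ [n _ <-] /= n_lt] := inf_adherent e_gt0 V_inf.
  exists (s n); near=> k; rewrite ballEmdist/=.
  have nk : (n <= k)%N by near: k; exact: nbhs_infty_ge.
  have [_] := s_below _ _ nk.
  have : inf V <= phi (s k) by apply: ge_inf; [exact: V_inf.2 | exists k].
  lra.
have /cvg_ex[/= a s_a] : cvg (s @ \oo) by exact: cauchy_cvg.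
have Aa : A a by exact: (closed_cvg A A_closed (nearW _ As) _ s_a).
have s_below_a n : below (s n) a.
  split=> //; apply/ler_addgt0Pr => e e_gt0.
  rewrite -lerBrDr.
  (* The slack [e] absorbs the distance from [s k] to [a], so the tail of [s] lies in the closed
     sublevel set at [K]. *)
  set K := _ - _; suff sK : \forall k \near \oo, phi (s k) <= K.
    exact: (closed_cvg _ (@phi_lsc K) sK _ s_a).
  near=> k; rewrite /K.
  have nk : (n <= k)%N by near: k; exact: nbhs_infty_ge.
  have [_ nk_le] := s_below _ _ nk.
  have ak : mdist a (s k) < e.
    by near: k; exact: metricType_numDomainType.cvgr_dist_lt.
  have := metric_triangle (s n) (s k) a.
  rewrite (metric_sym (s k)); lra.
exists a; split=> //; first by have [] := s_below_a 0%N.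
move=> y Ay ya.
suff ay_le : phi a <= phi y.
  apply/esym/mdist_positivity/eqP; rewrite eq_le mdist_ge0 andbT; lra.
apply/ler_addgt0Pr => e e_gt0.
have [n n_lt] : exists n, n.+1%:R^-1 < e.
  have [n _ nP] := near_infty_natSinv_lt (PosNum e_gt0).
  by exists n; exact: (nP n (leqnn n)).
have min_n z : below (s n) z -> phi (s n.+1) <= phi z + n.+1%:R^-1.
  by have [_] := nextP n _ (As n); exact.
(* By transitivity [y] lies below every [s n], so it competes in each near-minimal choice. *)
have := min_n y (below_trans (s_below_a n) (conj Ay ya)).
have [_] := s_below_a n.+1; have := mdist_ge0 (s n.+1) a.
move: n_lt; set u := n.+1%:R^-1; lra.
Unshelve. all: by end_near.
Qed.

End Ekeland.

(** * Distance to a set and sublevel sets of Lipschitz functions *)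

Section Distance.
Context {R : realType} {E : metricType R}.
Implicit Types (x y z : E) (X Y : set E).

Lemma dist_to_set_le z X x : X x -> dist_to_set z X <= mdist z x.
Proof.
move=> Xx; apply: ge_inf; last by exists x.
by exists 0 => _ [y _ <-]; exact: mdist_ge0.
Qed.

Lemma dist_to_set_ge z X r : X !=set0 ->
  (forall x, X x -> r <= mdist z x) -> r <= dist_to_set z X.
Proof.
move=> [x0 Xx0] r_le; apply: lb_le_inf; first by exists (mdist z x0), x0.
by move=> _ [x Xx <-]; exact: r_le.
Qed.

Lemma dist_to_set_lt z X r : X !=set0 -> dist_to_set z X < r ->
  exists2 x, X x & mdist z x < r.
Proof.
move=> X0 zr; apply: contrapT => no_x; move: zr; apply/negP; rewrite -leNgt.
apply: dist_to_set_ge => // x Xx; rewrite leNgt; apply/negP => xr.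
by apply: no_x; exists x.
Qed.

Lemma dist_to_set_ge0 z X : X !=set0 -> 0 <= dist_to_set z X.
Proof. by move=> X0; apply: dist_to_set_ge => // x _; exact: mdist_ge0. Qed.

Lemma dist_to_set0 z X : X z -> dist_to_set z X = 0.
Proof.
move=> Xz; apply/eqP; rewrite eq_le dist_to_set_ge0; last by exists z.
by rewrite -(mdistxx z) dist_to_set_le.
Qed.

Lemma dist_to_set_lip X x y : X !=set0 ->
  dist_to_set x X <= dist_to_set y X + mdist x y.
Proof.
move=> X0; rewrite -lerBlDr; apply: dist_to_set_ge => // z Xz.
have := dist_to_set_le x Xz; have := metric_triangle x y z; lra.
Qed.

Lemma dist_sets_le X Y x : X x -> Y !=set0 ->
  dist_sets X Y <= dist_to_set x Y.
Proof.
move=> Xx Y0; apply: dist_to_set_ge => // y Yy.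
apply: ge_inf; last by exists x, y.
by exists 0 => _ [? [? [_ _ ->]]]; exact: mdist_ge0.
Qed.

Lemma dist_sets_lt X Y r : X !=set0 -> Y !=set0 -> dist_sets X Y < r ->
  exists2 x, X x & dist_to_set x Y < r.
Proof.
move=> [x0 Xx0] [y0 Yy0] lt_r.
have [|_ [x [y [Xx Yy ->]]] xy] := inf_lt _ lt_r.
  by exists (mdist x0 y0), x0, y0.
by exists x; rewrite // (le_lt_trans (dist_to_set_le x Yy)).
Qed.

(** Serves both for the closedness of the petal and for the semicontinuity that Ekeland's principle
    asks for. *)
Lemma closed_sublevel_lipschitz (g : E -> R) (k K : R) :
  (forall x y, g x <= g y + k * mdist x y) -> closed [set x | g x <= K].
Proof.
move=> g_lip x xK /=; apply/ler_addgt0Pr => e e_gt0.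
(* The divisor is positive whatever the sign of [k]. *)
have d_gt0 : 0 < e / (1 + `|k|) by rewrite divr_gt0// ltr_pwDl.
have [y [/= gy]] := xK _ (nbhsx_ballx x _ d_gt0).
rewrite ballEmdist/= ltr_pdivlMr ?ltr_pwDl// => xy.
have := g_lip x y; have := ler_wpM2r (mdist_ge0 x y) (ler_norm k).
have := mdist_ge0 x y; lra.
Qed.

End Distance.

(** * Convex functions along geodesics and closed convex hulls *)

Section Convexity.
Context {R : realType} {E : metricType R}.
Implicit Types (x y z : E) (X Y : set E) (c : R -> E) (l t : R).

Lemma geodesic_path_rev c l x y : geodesic_path c l x y ->
  geodesic_path (fun t => c (l - t)) l y x.
Proof.
move=> [l0 cx cy c_iso]; split; rewrite ?subr0 ?subrr//.
move=> t t'; rewrite !in_itv/= => t_l t'_l.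
rewrite c_iso ?in_itv/=; [|lra..].
by rewrite distrC; congr `|_|; lra.
Qed.

Lemma geodesic_path_cst x : geodesic_path (fun=> x) 0 x x.
Proof.
split=> // t t'; rewrite !in_itv/= -!eq_le => /eqP <- /eqP <-.
by rewrite mdistxx subrr normr0.
Qed.

(** Rescales the parameter to [[0, 1]], as in [convex_metric]. *)
Lemma geodesic_segmentP (S : set E) x y z : geodesic_segment S x y -> S z ->
  exists c l t, [/\ geodesic_path c l x y, t \in `[0, 1] & z = c (t * l)].
Proof.
move=> [c [l [cP ->]]] [u /=]; rewrite in_itv/= => /andP[u0 ul] <-.
exists c, l; have [l0 _ _ _] := cP.
have [l_eq0|l_neq0] := eqVneq l 0.
  exists 0; rewrite in_itv/= lexx ler01 mul0r; split=> //; congr c; lra.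
exists (u / l); rewrite divfK// in_itv/= divr_ge0//=.
by rewrite ler_pdivrMr ?mul1r// lt_neqAle eq_sym l_neq0.
Qed.

Definition convex_along_geodesics (g : E -> R) : Prop :=
  forall c l x y t, geodesic_path c l x y -> t \in `[0, 1] ->
    g (c (t * l)) <= (1 - t) * g x + t * g y.

Lemma sublevel_geodesically_convex (g : E -> R) K :
  convex_along_geodesics g -> geodesically_convex [set x | g x <= K].
Proof.
move=> g_cvx x y S /= gx gy xyS z Sz /=.
have [c [l [t [cP t01 ->]]]] := geodesic_segmentP xyS Sz.
apply: le_trans (g_cvx _ _ _ _ _ cP t01) _; move: t01.
rewrite in_itv/= => /andP[t0 t1]; nra.
Qed.

Lemma closed_convex_hull_sub X Y : closed Y -> geodesically_convex Y ->
  X `<=` Y -> closed_convex_hull X `<=` Y.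
Proof.
move=> Y_closed Y_cvx XY; apply: (subset_trans _ Y_closed); apply: closureS.
have hullY n : geodesic_hulln n X `<=` Y.
  elim: n => // n IH z [x [y [S [Xx Xy xyS Sz]]]].
  exact: (Y_cvx x y S (IH _ Xx) (IH _ Xy) xyS).
by move=> z [n _]; exact: hullY.
Qed.

Lemma subset_closed_convex_hull X : X `<=` closed_convex_hull X.
Proof.
(* The hull starts at stage 1, which [x] enters as a degenerate segment. *)
move=> x Xx; apply: subset_closure; exists 1%N => //.
exists x, x, [set x]; split=> //; exists (fun=> x), 0; split.
  exact: geodesic_path_cst.
apply/seteqP; split=> [_ ->|_ [t _ <-]]//.
by exists 0; rewrite //= in_itv/= lexx.
Qed.

Section ConvexMetric.
Hypotheses (E_geodesic : geodesic_space E) (E_convex : convex_metric E).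

(* Comparison with the diagonal geodesic from [x] to [y'] reduces the claim to
   two geodesics with a common endpoint. *)
Lemma mdist_geodesics_convex c l x y c' l' x' y' t :
  geodesic_path c l x y -> geodesic_path c' l' x' y' -> t \in `[0, 1] ->
  mdist (c (t * l)) (c' (t * l')) <= (1 - t) * mdist x x' + t * mdist y y'.
Proof.
move=> cP c'P t01; have [h [m hP]] := E_geodesic x y'.
have t01' : 1 - t \in `[0, 1] by move: t01; rewrite !in_itv/=; lra.
have := E_convex cP hP t01.
(* [h] and [c'] share their end [y']; reversed they start there, and [t] becomes [1 - t]. *)
have := E_convex (geodesic_path_rev hP) (geodesic_path_rev c'P) t01'.
have complE u : u - (1 - t) * u = t * u by ring.
rewrite !subrr !complE.
have [_ _ -> _] := cP; have [_ -> -> _] := hP; have [_ -> _ _] := c'P.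
have := metric_triangle (c (t * l)) (h (t * m)) (c' (t * l')); lra.
Qed.

Lemma mdist_convex z : convex_along_geodesics (mdist ^~ z).
Proof.
move=> c l x y t cP t01.
exact: (mdist_geodesics_convex cP (geodesic_path_cst z) t01).
Qed.

(** Nearly closest points of [X] to [x] and [y] are joined by a geodesic inside [X], to which the
    given one is compared. *)
Lemma dist_to_set_convex X : X !=set0 -> geodesically_convex X ->
  convex_along_geodesics (dist_to_set ^~ X).
Proof.
move=> X0 X_cvx c l x y t cP t01; apply/ler_addgt0Pr => e e_gt0.
have [] := @dist_to_set_lt _ _ x X (dist_to_set x X + e) X0; first by rewrite ltrDl.
move=> x' Xx' xx'.
have [] := @dist_to_set_lt _ _ y X (dist_to_set y X + e) X0; first by rewrite ltrDl.
move=> y' Xy' yy'.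
have [c' [l' c'P]] := E_geodesic x' y'.
have Xc' : X (c' (t * l')).
  apply: (X_cvx _ _ (c' @` `[0, l']) Xx' Xy'); first by exists c', l'.
  exists (t * l') => //; have [l'0 _ _ _] := c'P.
  by move: t01; rewrite /= !in_itv/= => /andP[t0 t1]; rewrite mulr_ge0//= ler_piMl.
have := mdist_geodesics_convex cP c'P t01.
have := dist_to_set_le (c (t * l)) Xc'.
move: t01; rewrite in_itv/= => /andP[t0 t1]; nra.
Qed.

Lemma closed_convex_hull_petal (B : set E) (k : R) a x : 0 <= k ->
  B !=set0 -> geodesically_convex B ->
  (forall b, B b -> mdist b a <= k * dist_to_set a B) ->
  closed_convex_hull (B `|` [set a]) x ->
  k * dist_to_set x B + mdist x a <= k * dist_to_set a B.
Proof.
move=> k0 B0 B_cvx Ba.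
pose g z := k * dist_to_set z B + mdist z a.
have g_cvx : convex_along_geodesics g.
  move=> c l y z t cP t01; rewrite /g.
  have := ler_wpM2l k0 (dist_to_set_convex B0 B_cvx cP t01).
  have := mdist_convex a cP t01; lra.
have g_lip y z : g y <= g z + (k + 1) * mdist y z.
  rewrite /g; have := ler_wpM2l k0 (dist_to_set_lip y z B0).
  have := metric_triangle y z a; lra.
apply: (closed_convex_hull_sub (closed_sublevel_lipschitz g_lip)
  (sublevel_geodesically_convex g_cvx)) => z [Bz|->] /=; rewrite /g.
  by rewrite dist_to_set0// mulr0 add0r; exact: Ba.
by rewrite mdistxx addr0.
Qed.

End ConvexMetric.
End Convexity.

(** * The drop theorem for [A] and [B] *)

Theorem theorem5p3 (R : realType) (E : completeMetricType R)
  (E_geodesic : geodesic_space E) (E_convex : convex_metric E)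
  (A B : set E)
  (A_neq0 : A !=set0) (A_closed : closed A)
  (B_neq0 : B !=set0) (B_bounded : metric_bounded B) (B_closed : closed B)
  (B_convex : geodesically_convex B)
  (lambda_gt0 : 0 < dist_sets A B)
  (eps : R) (eps_gt0 : 0 < eps) :
  exists a : E,
    [/\ A a,
        dist_to_set a B < dist_sets A B + eps,
        closed_convex_hull (B `|` [set a]) `&` A = [set a] &
        forall x : nat -> E,
          (forall n, closed_convex_hull (B `|` [set a]) (x n)) ->
          dist_to_set (x n) A @[n --> \oo] --> (0 : R) ->
          x n @[n --> \oo] --> a].
Proof.
have [M BM] := B_bounded.
have [b0 Bb0] := B_neq0.
have M0 : 0 <= M by rewrite -(mdistxx b0); exact: BM.
set L := dist_sets A B in lambda_gt0 *.
pose f z := dist_to_set z B.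
pose C := M / L + 1.
have ML0 : 0 <= M / L by rewrite divr_ge0// ltW.
have C0 : 0 < C by rewrite /C; lra.
have f_ge z : A z -> L <= f z by move=> Az; exact: dist_sets_le.
(* Passing through points of [B] nearly closest to [z] costs at most [M], and [L <= f z] turns [M]
   into a multiple of [f z]. *)
have BC z b : A z -> B b -> mdist b z <= C * f z.
  move=> Az Bb; apply: (@le_trans _ _ (M + f z)).
    rewrite -lerBlDl; apply: dist_to_set_ge => // b' Bb'.
    have := metric_triangle b b' z; have := BM _ _ Bb Bb'.
    rewrite (metric_sym b' z); lra.
  rewrite /C mulrDl mul1r lerD2r.
  apply: (@le_trans _ _ (M / L * L)); first by rewrite divfK// gt_eqF.
  by rewrite ler_wpM2l// f_ge.
(* Starting Ekeland's principle at a nearly optimal [a0] yields (i), since [phi a <= phi a0]. *)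
have [a0 Aa0 a0_lt] : exists2 a0, A a0 & f a0 < L + eps.
  by apply: dist_sets_lt => //; rewrite ltrDl.
pose phi z := (C + 1) * f z.
have phi_lip x y : phi x <= phi y + (C + 1) * mdist x y.
  by rewrite /phi -mulrDr ler_wpM2l ?dist_to_set_lip//; lra.
have phi_ge z : A z -> 0 <= phi z.
  by move=> _; rewrite mulr_ge0 ?dist_to_set_ge0//; lra.
have [a [Aa a_le a_min]] := ekeland_variational_principle A_closed
  (fun K => closed_sublevel_lipschitz (K := K) phi_lip) phi_ge Aa0.
have petal x : closed_convex_hull (B `|` [set a]) x ->
    C * f x + mdist x a <= C * f a.
  by apply: closed_convex_hull_petal => //; [exact: ltW | move=> b; exact: BC].
exists a; split=> //.
- apply: le_lt_trans a0_lt.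
  have C1 : 0 < C + 1 by lra.
  by rewrite -/(f a) -(ler_pM2l C1); have := mdist_ge0 a0 a; move: a_le; rewrite /phi; lra.
- apply/seteqP; split=> [x [/petal ax Ax]|_ ->] /=; last first.
    by split=> //; apply: subset_closed_convex_hull; right.
  apply: a_min => //; rewrite /phi (metric_sym a).
  (* The petal inequality implies [f x <= f a]; adding this to it raises [C] to [C + 1]. *)
  have : C * f x <= C * f a by have := mdist_ge0 x a; lra.
  rewrite ler_pM2l//; lra.
move=> x Dx xA; apply/metricType_numDomainType.cvgrPdist_lt => e e_gt0.
(* The estimates below bound [mdist a (x n)] by [C * (C + 2)] times [mdist (x n) y], and [k] exceeds
   that factor. *)
pose k := 1 + (C + 1) * (C + 1).
have k_gt0 : 0 < k by rewrite /k; nra.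
have d_gt0 : 0 < e / k by rewrite divr_gt0.
have /cvgrPdist_lt/(_ _ d_gt0) := xA; apply: filterS => n.
rewrite sub0r normrN => /(le_lt_trans (ler_norm _)).
move=> /(dist_to_set_lt A_neq0)[y Ay].
rewrite ltr_pdivlMr// => xy.
(* The petal inequality gives [mdist a (x n) <= C * (f a - f (x n))], whereas
   minimality gives [(C + 1) * (f a - f y) <= mdist a y]. *)
have ay : phi a <= phi y + mdist a y.
  rewrite leNgt; apply/negP => lt_a.
  by have := lt_a; rewrite (a_min y Ay (ltW lt_a)) mdistxx addr0 ltxx.
have := petal _ (Dx n); rewrite (metric_sym _ a) => ax.
have := dist_to_set_lip y (x n) B_neq0; rewrite -!/(f _) (metric_sym y) => fxy.
have := metric_triangle a (x n) y => axy.
have d0 := mdist_ge0 (x n) y.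
move: ay; rewrite /phi => ay.
apply: le_lt_trans xy.
(* With these weights all values of [f] cancel, and [(C + 1) - C = 1] copy of [mdist a (x n)]
   remains. *)
have : C * ((C + 1) * f a) <= C * ((C + 1) * f y + mdist a y).
  by rewrite ler_wpM2l// ltW.
have := ler_wpM2l (ltW (mulr_gt0 C0 (addr_gt0 C0 ltr01))) fxy.
have := ler_wpM2l (ltW C0) axy.
have C1 : 0 <= C + 1 by lra.
have := ler_wpM2l C1 ax.
rewrite /k; lra.
Qed.
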